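(* Let $T\in\mathbb{B}(\mathcal{H})$ be binormal with the polar decomposition $T=U|T|$. Then the Duggal transform $T^{D}=|T|U$ is binormal if and only if $[U^{*}|T|U,\,UU^{*}]=0$.
   Context: $\mathbb{B}(\mathcal{H})$ denotes the bounded linear operators on a complex Hilbert space $\mathcal{H}$; $[A,B]=AB-BA$. An operator $S$ is binormal if $[S^{*}S,SS^{*}]=0$. The polar decomposition of $T$ is the unique factorization $T=U|T|$, where $|T|=(T^{*}T)^{1/2}$ and $U$ is a partial isometry with $\mathcal{N}(U)=\mathcal{N}(T)$. *)

(* Defs.v *)
From HB Require Import structures.
From mathcomp Require Import all_boot all_order all_algebra.
From mathcomp Require Import complex.
From mathcomp Require Import all_classical all_reals all_analysis.

Set Implicit Arguments.
Unset Strict Implicit.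
Unset Printing Implicit Defensive.

Import Order.TTheory GRing.Theory Num.Theory.
Import numFieldNormedType.Exports.

Local Open Scope classical_set_scope.
Local Open Scope complex_scope.
Local Open Scope ring_scope.

(* The inner product is linear in its first argument and conjugate-linear in
   the second one. Norms and inner products both take values in [R[i]]. *)
HB.mixin Record CompleteNormedModule_isHilbert (R : realType) H
    & CompleteNormedModule R[i] H := {
  inner_form : {dot H for Num.conj} ;
  normr_inner_subproof : forall x : H, `|x| ^+ 2 = inner_form x x
}.

#[short(type="hilbertType")]
HB.structure Definition Hilbert (R : realType) :=
  {H of CompleteNormedModule R[i] H & CompleteNormedModule_isHilbert R H}.

Section Inner.
Context {R : realType} {H : hilbertType R}.

Definition inner : H -> H -> R[i] := inner_form.

HB.instance Definition _ := Dot.copy inner inner_form.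

Lemma normr_inner (x : H) : `|x| ^+ 2 = inner x x.
Proof. exact: normr_inner_subproof. Qed.

End Inner.

Notation "''[' x , y ]" := (inner x y)
  (at level 0, format "''[' x ,  y ]") : ring_scope.

Section BoundedOperators.
Context {R : realType} (H : hilbertType R).

Definition is_bounded (f : H -> H) : Prop :=
  exists M : R, forall x, `|f x| <= M%:C * `|x|.

Definition bounded_linear : {pred H -> H} :=
  fun f => `[< linear f /\ is_bounded f >].

Record bop := Bop { bop_fun :> H -> H ; _ : bop_fun \in bounded_linear }.

HB.instance Definition _ := [isSub for bop_fun].
HB.instance Definition _ := [Choice of bop by <:].

Lemma bopP (f : H -> H) :
  reflect (linear f /\ is_bounded f) (f \in bounded_linear).
Proof. exact: asboolP. Qed.

Lemma bounded_linear_zmod_closed : zmod_closed bounded_linear.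
Proof.
split.
  apply/bopP; split=> [a x y|]; first by rewrite /= scaler0 addr0.
  by exists 0 => x; rewrite rmorph0 mul0r normr0.
move=> f g /bopP[lf [M fM]] /bopP[lg [N gN]]; apply/bopP; split.
  move=> a x y; rewrite -[LHS]/(f _ - g _) lf lg.
  by rewrite -[in RHS]/(f x - g x) -[in RHS]/(f y - g y) scalerBr opprD addrACA.
exists (M + N) => x; rewrite -[(f - g) x]/(f x - g x).
by rewrite rmorphD mulrDl (le_trans (ler_normB _ _)) ?lerD.
Qed.

HB.instance Definition _ :=
  GRing.isZmodClosed.Build (H -> H) bounded_linear bounded_linear_zmod_closed.
HB.instance Definition _ := [SubChoice_isSubZmodule of bop by <:].

Lemma bop_linear (T : bop) : linear T.
Proof. by case: T => f /= /bopP[]. Qed.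

Lemma bop_bounded (T : bop) : is_bounded T.
Proof. by case: T => f /= /bopP[]. Qed.

HB.instance Definition _ (T : bop) :=
  GRing.isLinear.Build R[i] H H *:%R (bop_fun T) (bop_linear T).

Lemma bop1_subproof : (idfun : H -> H) \in bounded_linear.
Proof. by apply/bopP; split=> //; exists 1 => x; rewrite mul1r. Qed.

Lemma bopM_subproof (S T : bop) : (S \o T : H -> H) \in bounded_linear.
Proof.
apply/bopP; split=> [a x y|]; first by rewrite /= !linearP.
have [[M SM] [N TN]] := (bop_bounded S, bop_bounded T).
exists (`|M| * N) => x /=; apply: (le_trans (SM _)).
rewrite rmorphM -mulrA (@le_trans _ _ (`|M|%:C * `|T x|)) //.
  by rewrite ler_wpM2r // lecR ler_norm.
by rewrite ler_wpM2l // lecR.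
Qed.

Definition bop1 : bop := Bop bop1_subproof.
Definition bopM (S T : bop) : bop := Bop (bopM_subproof S T).

Lemma bopMA : associative bopM. Proof. by move=> *; exact: val_inj. Qed.
Lemma bop1M : left_id bop1 bopM. Proof. by move=> *; exact: val_inj. Qed.
Lemma bopM1 : right_id bop1 bopM. Proof. by move=> *; exact: val_inj. Qed.
Lemma bopMDl : left_distributive bopM +%R.
Proof. by move=> *; exact: val_inj. Qed.
Lemma bopMDr : right_distributive bopM +%R.
Proof.
by move=> S T T'; apply/val_inj/funext => x /=; rewrite -[LHS]/(S (T x + T' x)) linearD.
Qed.

(* Only a [pzRing]: the zero space is a Hilbert space. *)
HB.instance Definition _ :=
  GRing.Zmodule_isPzRing.Build bop bopMA bop1M bopM1 bopMDl bopMDr.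

End BoundedOperators.

Notation "''B' ( H )" := (bop H) (at level 8, format "''B' ( H )") : type_scope.

Section Operators.
Context {R : realType} {H : hilbertType R}.
Implicit Types A B S T U : 'B(H).

Definition commutator A B : 'B(H) := A * B - B * A.

(* The adjoint exists and is unique by the Riesz representation theorem; the
   default value [0] is never used. *)
Definition adjoint T : 'B(H) :=
  xget 0 [set S : 'B(H) | forall x y, '[T x, y] = '[x, S y]].

(* [0 <= z] in [R[i]] includes that [z] is real. *)
Definition positive A : Prop := forall x, 0 <= '[A x, x].

(* The positive square root; it exists and is unique when [A] is positive. *)
Definition sqrt_op A : 'B(H) :=
  xget 0 [set P : 'B(H) | positive P /\ P * P = A].

Definition abs_op T : 'B(H) := sqrt_op (adjoint T * T).

Definition kernel T : set H := [set x | T x = 0].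

Definition orthogonal_complement (V : set H) : set H :=
  [set x | forall y, V y -> '[x, y] = 0].

Definition partial_isometry U : Prop :=
  forall x, orthogonal_complement (kernel U) x -> `|U x| = `|x|.

Definition polar_decomposition T U : Prop :=
  [/\ T = U * abs_op T, partial_isometry U & kernel U = kernel T].

Definition binormal T : Prop :=
  commutator (adjoint T * T) (T * adjoint T) = 0.

(* [U] is meant to be the partial isometry of the polar decomposition of [T]. *)
Definition duggal T U : 'B(H) := abs_op T * U.

End Operators.

(* Main.v *)
(* Write P = |T|, E = U U^*, F = U^* U and S = U^* P U. The modulus of T^* is
   U P U^*, so binormality of T makes it commute with P; conjugating by U and
   passing to range projections, S and E commute with P. The Duggal transform D
   satisfies D^* D = S^2 and D D^* = P^2 E, so it is binormal iff
   P^2 [S^2, E] = 0. As P and U have the same kernel, the range of [S^2, E] then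
   lies in ker F, while F [S^2, E] = [S^2, E]; hence E commutes with S^2, and so
   with its positive square root S.

   That self-adjoint operators commuting with P^2 commute with P >= 0 is shown
   without functional calculus: D = [X, P] is skew-adjoint and anticommutes with
   P, and a growth estimate for the form <P y, y> along the iterates of
   m + D^2, where m >= ||D||^2, forces P D = 0, whence D^3 = 0 and D = 0. *)

Require Import Defs.
From mathcomp Require Import all_boot all_order all_algebra.
From mathcomp Require Import complex.
From mathcomp Require Import all_classical all_reals all_analysis.
From mathcomp Require Import lra ring.
Import Order.TTheory GRing.Theory Num.Theory.
Import numFieldNormedType.Exports.
Local Open Scope ring_scope.
Local Open Scope complex_scope.

(** * The real part of the inner product *)

Section RealInner.
Context {R : realType} {H : hilbertType R}.
Implicit Types (x y z : H) (c : R).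

(** Real-valued, so that ordered-field reasoning applies; its values at [x] and ['i *: x] determine
    ['[x, y]]. *)
Definition rdot x y : R := complex.Re '[x, y].

Lemma rdotDl x y z : rdot (x + y) z = rdot x z + rdot y z.
Proof. by rewrite /rdot linearDl raddfD. Qed.

Lemma innerC x y : '[x, y] = ('[y, x])^*.
Proof. by rewrite hermC /= expr0 mul1r. Qed.

Lemma rdotC x y : rdot x y = rdot y x.
Proof. by rewrite /rdot innerC; case: '[y, x]. Qed.

Lemma rdotNl x y : rdot (- x) y = - rdot x y.
Proof. by rewrite /rdot linearNl raddfN. Qed.

Lemma rdotZl c x y : rdot (c%:C *: x) y = c * rdot x y.
Proof. by rewrite /rdot linearZl_LR /=; case: '[x, y] => a b /=; rewrite mul0r subr0. Qed.

Lemma rdot0l x : rdot 0 x = 0.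
Proof. by rewrite /rdot linear0l. Qed.

Lemma rdotBl x y z : rdot (x - y) z = rdot x z - rdot y z.
Proof. by rewrite rdotDl rdotNl. Qed.

Lemma rdotDr x y z : rdot z (x + y) = rdot z x + rdot z y.
Proof. by rewrite rdotC rdotDl !(rdotC z). Qed.

Lemma rdotNr x y : rdot x (- y) = - rdot x y.
Proof. by rewrite rdotC rdotNl rdotC. Qed.

Lemma rdotBr x y z : rdot z (x - y) = rdot z x - rdot z y.
Proof. by rewrite rdotDr rdotNr. Qed.

Lemma rdotZr c x y : rdot x (c%:C *: y) = c * rdot x y.
Proof. by rewrite rdotC rdotZl rdotC. Qed.

Lemma rdot0r x : rdot x 0 = 0.
Proof. by rewrite rdotC rdot0l. Qed.

Lemma normr_rdot x : `|x| ^+ 2 = (rdot x x)%:C.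
Proof. by rewrite normr_inner /rdot RRe_real // -normr_inner ger0_real // exprn_ge0. Qed.

Lemma rdot_ge0 x : 0 <= rdot x x.
Proof. by rewrite -lecR -normr_rdot exprn_ge0. Qed.

Lemma rdot_eq0 x : rdot x x = 0 -> x = 0.
Proof.
by move=> x0; apply/eqP; rewrite -normr_eq0 -(sqrf_eq0 `|x|) normr_rdot x0.
Qed.

Lemma rdot_ext x y : (forall z, rdot z x = rdot z y) -> x = y.
Proof.
move=> xy; apply/eqP; rewrite -subr_eq0; apply/eqP/rdot_eq0.
by rewrite rdotBr xy subrr.
Qed.

Lemma rdotZi x y : rdot ('i *: x) y = - complex.Im '[x, y].
Proof. by rewrite /rdot linearZl_LR /= mulrC ReiNIm. Qed.

Lemma inner_rdot x y : '[x, y] = rdot x y +i* - rdot ('i *: x) y.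
Proof. by rewrite rdotZi opprK /rdot; case: '[x, y]. Qed.

(** Expand [0 <= |c x - y|^2] and divide by [c]. *)
Lemma rdot_young c x y : 0 < c ->
  2 * rdot x y <= c * rdot x x + c^-1 * rdot y y.
Proof.
move=> c0; have := rdot_ge0 (c%:C *: x - y).
rewrite !(rdotBl, rdotBr, rdotZl, rdotZr) (rdotC y x) => h.
have : 0 <= c^-1 * (c * (c * rdot x x) - c * rdot x y - (c * rdot x y - rdot y y)).
  by apply: mulr_ge0; [rewrite invr_ge0 ltW | lra].
suff -> : c^-1 * (c * (c * rdot x x) - c * rdot x y - (c * rdot x y - rdot y y)) =
  c * rdot x x + c^-1 * rdot y y - 2 * rdot x y by rewrite subr_ge0.
by field; rewrite gt_eqF.
Qed.

Lemma rdot_cauchy_lim (u : nat -> H) :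
  (forall e : R, 0 < e -> exists N, forall k l, (N <= k)%N -> (N <= l)%N ->
     rdot (u k - u l) (u k - u l) < e) ->
  exists v, forall e : R, 0 < e -> exists N, forall k, (N <= k)%N ->
     rdot (u k - v) (u k - v) < e.
Proof.
move=> uC.
have ltn x (e : R) : 0 < e -> (`|x| < e%:C) = (rdot x x < e ^+ 2).
  move=> e0; rewrite -(@ltr_pXn2r _ 2) ?nnegrE ?normr_ge0 ?lecR ?ltW //.
  by rewrite normr_rdot -rmorphXn ltcR.
(* A positive element of [R[i]] is real, so real tolerances suffice. *)
have pos (e : R[i]) : 0 < e -> exists2 r : R, 0 < r & e = r%:C.
  case: e => a b; rewrite ltcE /= => /andP[/eqP -> a0].
  by exists a.
have cu : cvg (u @ \oo)%classic.
  apply/cauchy_cvgP/cauchy_exP => e /pos[r r0 ->].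
  have [N hN] := uC (r ^+ 2) (exprn_gt0 _ r0).
  exists (u N); exists N => // k /= Nk.
  by rewrite -ball_normE /= ltn // hN.
exists (lim (u @ \oo)%classic) => e e0.
have se : 0 < Num.sqrt e by rewrite sqrtr_gt0.
have /cvgrPdist_lt/(_ (Num.sqrt e)%:C) := cu.
rewrite ltcR => /(_ se)[N _ hN].
exists N => k /hN /=; rewrite ltn // sqr_sqrtr ?ltW //.
by rewrite -opprB rdotNl rdotNr opprK.
Qed.

End RealInner.

(** * Riesz representation on the kernel of a bounded operator *)

Section Riesz.
Context {R : realType} {H : hilbertType R}.
Implicit Types (x y z : H) (c : R) (S T K : 'B(H)).

Lemma bop_rdot_bound T :
  exists2 L : R, 0 < L & forall x, rdot (T x) (T x) <= L * rdot x x.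
Proof.
have [M hM] := bop_bounded T; exists (M ^+ 2 + 1) => [|x].
  by rewrite ltr_wpDl // sqr_ge0.
have : `|T x| ^+ 2 <= (M%:C * `|x|) ^+ 2.
  by rewrite lerXn2r // nnegrE ?normr_ge0 // (le_trans _ (hM x)).
rewrite exprMn !normr_rdot -rmorphXn -rmorphM lecR => /le_trans; apply.
by rewrite mulrDl lerDl mul1r rdot_ge0.
Qed.

Lemma bop_is_bounded (f : H -> H) (L : R) :
  (forall x, rdot (f x) (f x) <= L * rdot x x) -> is_bounded f.
Proof.
move=> fL; exists (`|L| + 1) => x.
rewrite -(@ler_pXn2r _ 2) ?nnegrE ?mulr_ge0 ?normr_ge0 ?lecR ?addr_ge0 //.
rewrite exprMn !normr_rdot -rmorphXn -rmorphM lecR (le_trans (fL x)) //.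
apply: ler_wpM2r; first exact: rdot_ge0.
have := ler_norm L; have := normr_ge0 L; nra.
Qed.

Lemma le0_of_natr_mul_le (a b : R) : (forall n : nat, n%:R * a <= b) -> a <= 0.
Proof.
move=> ab; rewrite leNgt; apply/negP => a0.
have := ab (Num.Def.truncn (b / a)).+1.
rewrite leNgt => /negP; apply; rewrite -ltr_pdivrMr //.
exact: truncnS_gt.
Qed.

(* The minimizer of [|w|^2 - 2 Re <S w, y>] over the kernel of [K]; the
   parallelogram law makes any minimizing sequence Cauchy. *)
Lemma riesz_kernel K S y :
  exists2 v, K v = 0 & forall w, K w = 0 -> rdot w v = rdot (S w) y.
Proof.
have [L L0 SL] := bop_rdot_bound S.
have [M M0 KM] := bop_rdot_bound K.
pose J w := rdot w w - 2 * rdot (S w) y.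
have J_ge w : - (L * rdot y y) <= J w.
  (* The weight [L^-1] bounds the contribution of [S w] by [rdot w w], which cancels in [J]. *)
  have := @rdot_young _ _ L^-1 (S w) y; rewrite invr_gt0 invrK => /(_ L0).
  have : L^-1 * rdot (S w) (S w) <= rdot w w by rewrite mulrC ler_pdivrMr // mulrC.
  by rewrite /J; lra.
pose E := [set J w | w in [set w | K w = 0]]%classic.
have E0 : (E !=set0)%classic by exists (J 0), 0 => //=; rewrite linear0.
have Einf : has_inf E.
  by split=> //; exists (- (L * rdot y y)) => _ [w _ <-].
pose j := inf E.
have j_le w : K w = 0 -> j <= J w.
  by move=> Kw; apply: ge_inf; [exact: Einf.2 | exists w].
have /choice[u hu] : forall k : nat, exists w, K w = 0 /\ J w < j + k.+1%:R^-1.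
  move=> k; have k0 : 0 < k.+1%:R^-1 :> R by rewrite invr_gt0 ltr0n.
  have [_ [w /= Kw <-] Jw] := inf_adherent k0 Einf.
  by exists w.
have KD a w z : K w = 0 -> K z = 0 -> K (a *: w + z) = 0.
  by move=> Kw Kz; rewrite bop_linear Kw Kz scaler0 addr0.
have JD c w z : J (c%:C *: w + z) = J z + 2 * c * (rdot z w - rdot (S w) y) + c ^+ 2 * rdot w w.
  rewrite /J bop_linear !(rdotDl, rdotDr, rdotZl, rdotZr) (rdotC w z).
  by ring.
have small (e : R) : 0 < e -> exists N, forall k, (N <= k)%N -> k.+1%:R^-1 < e.
  move=> e0; exists (Num.Def.truncn e^-1) => k Nk.
  rewrite -[e]invrK ltf_pV2 ?posrE ?invr_gt0 ?ltr0n //.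
  by rewrite (lt_le_trans (truncnS_gt _)) // ler_nat.
have uC (e : R) : 0 < e -> exists N, forall k l, (N <= k)%N -> (N <= l)%N ->
     rdot (u k - u l) (u k - u l) < e.
  move=> e0; have [|N hN] := small (e / 4); first by rewrite divr_gt0.
  exists N => k l /hN Nk /hN Nl.
  have [[Kk Jk] [Kl Jl]] := (hu k, hu l).
  (* At the midpoint [J] is still at least [j], so [|u k - u l|^2] is at most twice the sum of the
     excesses of [J (u k)] and [J (u l)] over [j]; hence [e / 4]. *)
  have /j_le : K ((2^-1)%:C *: (u k - u l) + u l) = 0.
    by apply: KD => //; rewrite linearB /= Kk Kl subrr.
  have := JD 1 (u k - u l) (u l); rewrite rmorph1 scale1r subrK.
  rewrite JD.
  set p := k.+1%:R^-1 in Nk Jk; set q := l.+1%:R^-1 in Nl Jl. lra.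
have [v hv] := rdot_cauchy_lim _ uC.
have Kv : K v = 0.
  apply: rdot_eq0; apply/eqP; rewrite eq_le rdot_ge0 andbT.
  apply/ler_addgt0Pl => e e0; rewrite addr0.
  have [|N /(_ N (leqnn _)) hN] := hv (e / M); first by rewrite divr_gt0.
  have := KM (u N - v); rewrite linearB /= (hu N).1 sub0r rdotNl rdotNr opprK.
  move=> /le_trans; apply; rewrite mulrC -ler_pdivlMr //; exact: ltW.
exists v => // w Kw.
(* First variation along [w], computed at [u k] rather than at [v]; absorbing [u k - v] by Young's
   inequality doubles the quadratic term. *)
have ineq s : 0 <= 2 * s * (rdot v w - rdot (S w) y) + s ^+ 2 * (2 * rdot w w).
  apply/ler_addgt0Pl => e e0.
  have [|N1 h1] := small (e / 2); first by rewrite divr_gt0.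
  have [|N2 h2] := hv (e / 2); first by rewrite divr_gt0.
  have /h1 {}h1 := leq_maxl N1 N2; have /h2 {}h2 := leq_maxr N1 N2.
  set k := maxn N1 N2 in h1 h2.
  have [Kk Jk] := hu k.
  have := j_le _ (KD s%:C _ _ Kw Kk); rewrite JD.
  have := rdot_young 1 (u k - v) (s%:C *: w) ltr01.
  rewrite !(rdotZl, rdotZr) (rdotBl (u k) v w) invr1 !mul1r => young ge.
  set p := k.+1%:R^-1 in h1 Jk. lra.
rewrite (rdotC w v); apply/eqP; rewrite -subr_eq0 -sqrf_eq0; apply/eqP.
set a := _ - _ in ineq *; set b := rdot w w in ineq.
have b0 : 0 <= b := rdot_ge0 w.
(* Close to the minimizer [- a / (2 * b)] of the quadratic, but defined also for [b = 0]. *)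
have := ineq (- a / (2 * b + 1)).
have c0 : 0 < 2 * b + 1 by lra.
have -> : 2 * (- a / (2 * b + 1)) * a + (- a / (2 * b + 1)) ^+ 2 * (2 * b) =
  - a ^+ 2 * ((2 * b + 2) / (2 * b + 1) ^+ 2).
  by field; rewrite gt_eqF.
rewrite pmulr_lge0; last by rewrite divr_gt0 ?exprn_gt0 //; lra.
by rewrite oppr_ge0 => a2; apply/eqP; rewrite eq_le a2 sqr_ge0.
Qed.

End Riesz.

(** * Adjoints and positive operators *)

Section Adjoint.
Context {R : realType} {H : hilbertType R}.
Implicit Types (x y z : H) (c : R) (S T K P X : 'B(H)).

Lemma inner_rdot_eq T S : (forall x y, rdot (T x) y = rdot x (S y)) ->
  forall x y, '[T x, y] = '[x, S y].
Proof.
move=> TS x y; rewrite !inner_rdot TS; congr (_ +i* - _).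
by rewrite -TS linearZ.
Qed.

Lemma adjoint_exists T :
  exists S : 'B(H), forall x y, '[T x, y] = '[x, S y].
Proof.
have /choice[s hs] : forall y, exists v, forall w, rdot w v = rdot (T w) y.
  (* The kernel of [0] is the whole space. *)
  move=> y; have [v _ hv] := riesz_kernel 0 T y.
  by exists v => w; apply: hv.
have iP x y : '[T x, y] = '[x, s y].
  rewrite !inner_rdot hs; congr (_ +i* - _).
  by rewrite hs linearZ.
have [L L0 TL] := bop_rdot_bound T.
have sP : s \in @bounded_linear R H.
  apply/bopP; split.
    move=> a x y; apply: rdot_ext => z; rewrite /rdot -iP.
    rewrite !(linearDr, linearZr_LR) /=.
    by rewrite -!iP.
  apply: (@bop_is_bounded _ _ _ L) => y.
  have := rdot_young L^-1 (T (s y)) y; rewrite invr_gt0 invrK -hs => /(_ L0).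
  have : L^-1 * rdot (T (s y)) (T (s y)) <= rdot (s y) (s y).
    by rewrite mulrC ler_pdivrMr // mulrC.
  lra.
by exists (Bop sP).
Qed.

Lemma rdot_adjoint T x y : rdot (T x) y = rdot x (adjoint T y).
Proof.
by rewrite /rdot (xgetPex (0 : 'B(H)) (adjoint_exists T) x y).
Qed.

Lemma bop_eqP S T : (forall x, S x = T x) <-> S = T.
Proof. by split=> [ST | -> //]; apply/val_inj/funext. Qed.

Lemma adjoint_uniq T S : (forall x y, rdot (T x) y = rdot x (S y)) ->
  adjoint T = S.
Proof.
move=> TS; apply/bop_eqP => y; apply: rdot_ext => x.
by rewrite -rdot_adjoint TS.
Qed.

Lemma adjointK T : adjoint (adjoint T) = T.
Proof.
by apply: adjoint_uniq => x y; rewrite rdotC -rdot_adjoint rdotC.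
Qed.

Lemma adjointM S T : adjoint (S * T) = adjoint T * adjoint S.
Proof.
apply: adjoint_uniq => x y; rewrite -[LHS]/(rdot (S (T x)) y).
by rewrite !rdot_adjoint.
Qed.

Lemma adjointB S T : adjoint (S - T) = adjoint S - adjoint T.
Proof.
apply: adjoint_uniq => x y; rewrite -[LHS]/(rdot (S x - T x) y).
by rewrite rdotBl !rdot_adjoint -rdotBr.
Qed.

Lemma positive_ge0 P x : positive P -> 0 <= rdot (P x) x.
Proof. by move=> /(_ x); rewrite inner_rdot lecE /= => /andP[]. Qed.

(** Polarization: the form is real at [x], ['i *: y] and their sum, so the imaginary parts of the
    cross terms cancel. *)
Lemma positive_adjoint P : positive P -> adjoint P = P.
Proof.
move=> P0; apply: adjoint_uniq => x y.
have Im0 z : rdot ('i *: P z) z = 0.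
  by have := P0 z; rewrite inner_rdot lecE /= oppr_eq0 => /andP[/eqP].
have ii z : 'i *: ('i *: z) = - z :> H by rewrite scalerA -expr2 sqr_i scaleN1r.
have rdotii z w : rdot ('i *: z) ('i *: w) = rdot z w.
  rewrite rdotZi linearZr_LR /= innerC /rdot.
  rewrite [in RHS]innerC.
  case: '[w, z] => a b /=; ring.
have := Im0 (x + 'i *: y).
rewrite linearD scalerDr linearZ /= ii !(rdotDl, rdotDr) !rdotNl rdotii.
rewrite Im0.
have := Im0 ('i *: y); rewrite linearZ /= ii rdotNl => ->.
rewrite (rdotC (P y)); lra.
Qed.

Lemma rdot_positive P x y : positive P -> rdot (P x) y = rdot x (P y).
Proof. by move=> P0; rewrite rdot_adjoint positive_adjoint. Qed.

Lemma positive_conj P S : positive P -> positive (adjoint S * P * S).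
Proof.
move=> P0 x; rewrite -[X in 0 <= '[X, _]]/(adjoint S (P (S x))).
rewrite (@inner_rdot_eq _ S) ?P0 // => u v.
by rewrite rdotC -rdot_adjoint rdotC.
Qed.

Lemma adjoint_mul_eq0 T : adjoint T * T = 0 -> T = 0.
Proof.
move=> T0; apply/bop_eqP => x; apply: rdot_eq0.
by rewrite rdot_adjoint -[adjoint T (T x)]/((adjoint T * T) x) T0 rdot0r.
Qed.

End Adjoint.

(** * Commutation with positive square roots *)

Section Commutation.
Context {R : realType} {H : hilbertType R}.
Implicit Types (x y z : H) (c : R) (D S T P U X : 'B(H)).

Lemma positive_form_le P : positive P ->
  exists2 k : R, 0 < k & forall x, rdot (P x) x <= k * rdot x x.
Proof.
move=> P0; have [L L0 PL] := bop_rdot_bound P.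
exists (L + 1) => [|x]; first by rewrite addr_gt0.
have := rdot_young 1 (P x) x ltr01; have := PL x.
by have := positive_ge0 _ x P0; rewrite invr1 !mul1r mulrDl mul1r; lra.
Qed.

(** With [k] bounding the form, its value at [x - k^-1 P x] is nonnegative and at most
    [- k^-1 |P x|^2]. *)
Lemma positive_form_eq0 P x : positive P -> rdot (P x) x = 0 -> P x = 0.
Proof.
move=> P0 Px; have [k k0 Pk] := positive_form_le _ P0.
have kPx := Pk (P x).
have := positive_ge0 _ (x - (k^-1)%:C *: P x) P0.
rewrite linearB linearZ /= !(rdotBl, rdotBr, rdotZl, rdotZr) Px.
rewrite (rdot_positive P (P x) x) // => h.
apply/rdot_eq0/eqP; rewrite eq_le rdot_ge0 andbT.
have : k^-1 * rdot (P (P x)) (P x) <= rdot (P x) (P x).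
  by rewrite mulrC ler_pdivrMr // mulrC.
have := h; rewrite -(pmulr_rge0 _ k0) !mulrBr !mulr0 !mulrA mulfV ?gt_eqF // !mul1r.
by lra.
Qed.

(* With [m >= ||D||^2] and [B = m + D^2], the form [q y = Re <P y, y>] satisfies
   [q (B y) = m^2 q y + 2 m q (D y) + q (D^2 y)], whereas [|B y| <= m |y|].
   Hence [q (B^n x)] is at least of order [n m^(2n) q (D x)] and at most of
   order [m^(2n)], which forces [q (D x) = 0]. *)
Lemma skew_anticommute_eq0 P D : positive P -> adjoint D = - D ->
  P * D = - (D * P) -> P * D = 0.
Proof.
move=> P0 Dskew PD.
have Dr x y : rdot (D x) y = - rdot x (D y).
  by rewrite rdot_adjoint Dskew -[(- D) y]/(- D y) rdotNr.
have PDx x : P (D x) = - D (P x).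
  by rewrite -[LHS]/((P * D) x) PD.
have [m m0 Dm] := bop_rdot_bound D; have [k k0 Pk] := positive_form_le _ P0.
pose q y := rdot (P y) y.
have q0 y : 0 <= q y by exact: positive_ge0.
pose b y := D (D y) + m%:C *: y.
have Db y : D (b y) = b (D y) by rewrite /b linearD linearZ.
have qb y : q (b y) = m ^+ 2 * q y + 2 * m * q (D y) + q (D (D y)).
  rewrite /q /b linearD linearZ /= !(rdotDl, rdotDr, rdotZl, rdotZr).
  rewrite (rdot_positive P (D (D y)) y) // (rdotC (D (D y))).
  (* The sign from anticommutation cancels the one from skewness. *)
  have -> : rdot (P y) (D (D y)) = rdot (P (D y)) (D y).
    by rewrite PDx rdotNl Dr opprK.
  by ring.
have nb y : rdot (b y) (b y) <= m ^+ 2 * rdot y y.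
  rewrite /b !(rdotDl, rdotDr, rdotZl, rdotZr) (rdotC y (D (D y))).
  rewrite (Dr (D y) y); have := Dm (D y); have := rdot_ge0 (D y).
  by nra.
apply/bop_eqP => x; apply: (@positive_form_eq0 P (D x)) => //; apply/eqP.
rewrite -/(q (D x)) eq_le q0 andbT.
pose Y n := iter n b x.
have qDY n : (m ^+ 2) ^+ n * q (D x) <= q (D (Y n)).
  elim: n => [|n IHn]; first by rewrite mul1r.
  rewrite [Y n.+1]/= Db qb exprS -mulrA.
  have := q0 (D (D (Y n))); have := q0 (D (D (D (Y n)))).
  have : m ^+ 2 * ((m ^+ 2) ^+ n * q (D x)) <= m ^+ 2 * q (D (Y n)).
    by rewrite ler_wpM2l ?sqr_ge0.
  by nra.
(* The factor [m] on the right avoids the exponent [2 n - 1]. *)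
have qY n : n%:R * (2 * (m ^+ 2) ^+ n * q (D x)) <= m * q (Y n).
  elim: n => [|n IHn]; first by rewrite mul0r mulr_ge0 // ltW.
  rewrite [Y n.+1]/= qb exprS -natr1.
  have m2 : 0 <= m ^+ 2 by exact: sqr_ge0.
  have h1 := ler_wpM2l m2 IHn; have h2 := ler_wpM2l m2 (qDY n).
  have h3 : 0 <= m * q (D (D (Y n))) by rewrite mulr_ge0 // ltW.
  by lra.
have nY n : rdot (Y n) (Y n) <= (m ^+ 2) ^+ n * rdot x x.
  elim: n => [|n IHn]; first by rewrite mul1r.
  rewrite exprS -mulrA (le_trans (nb _)) // ler_wpM2l //; exact: sqr_ge0.
suff : 2 * q (D x) <= 0 by lra.
apply: (@le0_of_natr_mul_le _ _ (m * (k * rdot x x))) => n.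
have mn : 0 < (m ^+ 2) ^+ n by rewrite !exprn_gt0.
rewrite -(ler_pM2l mn); have := qY n.
have : m * q (Y n) <= m * (k * ((m ^+ 2) ^+ n * rdot x x)).
  by rewrite ler_pM2l // (le_trans (Pk _)) // ler_pM2l.
by lra.
Qed.

Lemma commute_positive_sqrt P X : positive P -> adjoint X = X ->
  X * (P * P) = P * P * X -> X * P = P * X.
Proof.
move=> P0 Xsa XPP; pose D := X * P - P * X.
have Dskew : adjoint D = - D.
  by rewrite adjointB !adjointM Xsa positive_adjoint // opprB.
(* [P D + D P] is the commutator of [X] and [P * P]. *)
have PD : P * D = - (D * P).
  by rewrite /D mulrBr mulrBl opprB -(mulrA X) XPP !mulrA.
have PD0 := skew_anticommute_eq0 _ _ P0 Dskew PD.
have DP0 : D * P = 0 by apply/eqP; rewrite -oppr_eq0 -PD PD0.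
have DDD : D * (D * D) = 0.
  have -> : D * D = - (P * X * D).
    by rewrite {1}/D mulrBl -(mulrA X) PD0 mulr0 sub0r.
  by rewrite mulrN !mulrA DP0 !mul0r oppr0.
(* [D * D] is self-adjoint, and its square vanishes. *)
have DD : D * D = 0.
  by apply: adjoint_mul_eq0; rewrite adjointM Dskew mulrNN -mulrA DDD mulr0.
suff /eqP : D = 0 by rewrite subr_eq0 => /eqP.
by apply: adjoint_mul_eq0; rewrite Dskew mulNr DD oppr0.
Qed.

(** * Partial isometries and the polar decomposition *)

(** Both [U] and its adjoint are contractions, so expanding [|U^* U x - x|^2] with [|U x| = |x|]
    leaves at most 0. *)
Lemma partial_isometry_adjoint U x : partial_isometry U ->
  (forall y, U y = 0 -> rdot x y = 0) -> adjoint U (U x) = x.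
Proof.
move=> Uiso xU.
have iso z : (forall y, U y = 0 -> rdot z y = 0) -> rdot (U z) (U z) = rdot z z.
  (* The kernel is stable under ['i], so real orthogonality to it is complex orthogonality. *)
  move=> zU; have /Uiso Uz : orthogonal_complement (Defs.kernel U) z.
    move=> y Uy; rewrite inner_rdot zU // rdotC.
    suff -> : rdot y ('i *: z) = - rdot z ('i *: y).
      by rewrite zU ?oppr0 //= linearZ /= Uy scaler0.
    rewrite rdotC rdotZi (rdotC z) rdotZi opprK innerC.
    by case: '[y, z] => a b /=; rewrite opprK.
  by have := congr1 (fun r => complex.Re (r ^+ 2)) Uz; rewrite /= !normr_rdot.
have U_le z : rdot (U z) (U z) <= rdot z z.
  (* [v] is the orthogonal projection of [z] onto the kernel. *)
  have [v Uv hv] := riesz_kernel U 1 z.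
  have zv y : U y = 0 -> rdot (z - v) y = 0.
    by move=> Uy; rewrite rdotBl -!(rdotC y) hv // subrr.
  have := iso _ zv; rewrite linearB /= Uv subr0 => ->.
  have := zv _ Uv; have := rdot_ge0 v.
  by rewrite !(rdotBl, rdotBr) (rdotC v z); lra.
have adjU_le y : rdot (adjoint U y) (adjoint U y) <= rdot y y.
  have := rdot_young 1 (U (adjoint U y)) y ltr01; rewrite invr1 !mul1r.
  rewrite rdot_adjoint; have := U_le (adjoint U y); lra.
apply/eqP; rewrite -subr_eq0; apply/eqP/rdot_eq0/eqP.
rewrite eq_le rdot_ge0 andbT !(rdotBl, rdotBr) (rdotC (adjoint U (U x)) x).
by rewrite -(rdot_adjoint U x) iso //; have := adjU_le (U x); rewrite iso //; lra.
Qed.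

Lemma partial_isometryK U : partial_isometry U -> U * adjoint U * U = U.
Proof.
move=> Uiso; apply/bop_eqP => z.
have [v Uv hv] := riesz_kernel U 1 z.
have : adjoint U (U (z - v)) = z - v.
  apply: partial_isometry_adjoint => // y Uy.
  by rewrite rdotBl -!(rdotC y) hv // subrr.
by rewrite linearB /= Uv subr0 => /(congr1 U); rewrite linearB /= Uv subr0.
Qed.

(* If [T^* T] had no positive square root, [abs_op T] would be the default
   value [0], so that [T = U * 0 = 0] and [0] would be such a root. *)
Lemma abs_opP T U : T = U * abs_op T ->
  positive (abs_op T) /\ abs_op T * abs_op T = adjoint T * T.
Proof.
move=> TU; pose roots := [set P : 'B(H) | positive P /\ P * P = adjoint T * T]%classic.
apply: (@xgetPex _ 0 roots); apply: contrapT => noP.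
have T0 : T = 0.
  rewrite TU /abs_op /sqrt_op xgetPN ?mulr0 // => P PT.
  by apply: noP; exists P.
apply: noP; exists 0; split=> [x|]; last by rewrite T0 !mulr0.
by rewrite -[X in '[X, _]]/(0 : H) linear0l.
Qed.

Lemma polar_kernel T U x : polar_decomposition T U ->
  abs_op T x = 0 <-> U x = 0.
Proof.
case=> TU _ UT; have [P0 PP] := abs_opP _ _ TU.
have -> : U x = 0 <-> T x = 0.
  by rewrite -[U x = 0]/(Defs.kernel U x) UT.
split=> [Px | Tx].
  by rewrite TU -[LHS]/(U (abs_op T x)) Px linear0.
have PPx : (abs_op T * abs_op T) x = 0.
  by rewrite PP -[LHS]/(adjoint T (T x)) Tx linear0.
by apply: rdot_eq0; rewrite rdot_positive // -[X in rdot x X]/((abs_op T * abs_op T) x) PPx rdot0r.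
Qed.

Lemma kernel_mul_eq0 S T X : (forall x, S x = 0 -> T x = 0) ->
  S * X = 0 -> T * X = 0.
Proof.
by move=> ST SX; apply/bop_eqP => x; apply: ST; rewrite -[LHS]/((S * X) x) SX.
Qed.

End Commutation.

(** * Binormality of the Duggal transform *)

Theorem theorem3p14 (R : realType) (H : hilbertType R) (T U : 'B(H))
    (T_binormal : binormal T) (T_polar : polar_decomposition T U) :
  binormal (duggal T U) <->
  commutator (adjoint U * abs_op T * U) (U * adjoint U) = 0.
Proof.
have [TU Uiso _] := T_polar.
have [P0 PP] := abs_opP _ _ TU.
have kerPU x := polar_kernel _ _ x T_polar.
rewrite /duggal; set P := abs_op T in TU P0 PP kerPU *.
have Psa : adjoint P = P by exact: positive_adjoint.
pose V := adjoint U; rewrite -/V.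
have UVU : U * V * U = U by exact: partial_isometryK.
have VUV : V * U * V = V.
  by have := congr1 adjoint UVU; rewrite !adjointM adjointK -/V mulrA.
(* The range of the self-adjoint [P] is orthogonal to its kernel, which is that of [U]. *)
have VUP : V * U * P = P.
  apply/bop_eqP => x; apply: partial_isometry_adjoint => // y /kerPU Py.
  by rewrite rdot_positive // Py rdot0r.
have PVU : P * V * U = P.
  by have := congr1 adjoint VUP; rewrite !adjointM adjointK Psa -/V mulrA.
(* The existentials keep these products opaque to rewriting; [Q] is the modulus of the adjoint of
   [T]. *)
have [Q defQ] : exists Q, Q = U * P * V by exists (U * P * V).
have [E defE] : exists E, E = U * V by exists (U * V).
have [F defF] : exists F, F = V * U by exists (V * U).
have [S defS] : exists S, S = V * P * U by exists (V * P * U).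
have Q0 : positive Q.
  by have := positive_conj _ V P0; rewrite adjointK defQ.
have S0 : positive S by rewrite defS; exact: positive_conj.
have Esa : adjoint E = E by rewrite defE adjointM adjointK.
have Fsa : adjoint F = F by rewrite defF adjointM adjointK.
have PF : P * F = P by rewrite defF mulrA.
have EU : E * U = U by rewrite defE.
have VE : V * E = V by rewrite defE mulrA.
have QQ : Q * Q = T * adjoint T.
  by rewrite [in RHS]TU adjointM Psa -/V defQ !mulrA -(mulrA U P V) -(mulrA U _ U) PVU.
(* Binormality makes the squares commute; one square is removed at a time. *)
have PQ : Q * P = P * Q.
  have Qsa := positive_adjoint _ Q0.
  apply: commute_positive_sqrt => //.
  symmetry; apply: commute_positive_sqrt => //; first by rewrite adjointM Psa.
  by rewrite PP QQ; apply/eqP; rewrite -subr_eq0; apply/eqP.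
have SP : S * P = P * S.
  have := congr1 (fun X => V * X * U) PQ; rewrite defQ defS /= !mulrA VUP.
  by rewrite -(mulrA (V * P * U) P V) -(mulrA (V * P * U) _ U) PVU => ->.
have EP : E * P = P * E.
  have kerQV y : Q y = 0 -> V y = 0.
    move=> Qy; have /(positive_form_eq0 _ _ P0)/kerPU : rdot (P (V y)) (V y) = 0.
      by rewrite -rdot_adjoint -[U _]/((U * P * V) y) -defQ Qy rdot0l.
    move=> UVy; suff : (V * U * V) y = 0 by rewrite VUV.
    by rewrite -[LHS]/(V (U (V y))) UVy linear0.
  (* [Q] kills [P * (1 - E)], as it commutes with [P] and [Q * E = Q]. This yields [E P = E P E],
     whose adjoint gives commutation. *)
  have : V * (P * (1 - E)) = 0.
    apply: (kernel_mul_eq0 _ _ _ kerQV).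
    by rewrite mulrA PQ -mulrA mulrBr mulr1 defQ -(mulrA _ V E) VE subrr mulr0.
  move=> /(congr1 ( *%R U)); rewrite mulr0 !mulrA -defE mulrBr mulr1.
  move=> /eqP; rewrite subr_eq0 => /eqP EPE.
  by have := congr1 adjoint EPE; rewrite !adjointM Esa Psa mulrA -EPE => ->.
have SS : S * S = V * (P * P) * U.
  by rewrite {1}defS -mulrA defS !mulrA -(mulrA _ U V) -defE -(mulrA _ E P) EP
    !mulrA -(mulrA _ E U) EU.
have DD : adjoint (P * U) * (P * U) = S * S.
  by rewrite adjointM Psa SS !mulrA.
have DD' : P * U * adjoint (P * U) = P * P * E.
  by rewrite adjointM Psa -/V !mulrA -(mulrA P U V) -defE -(mulrA P E P) EP mulrA.
have SSP : S * S * (P * P) = P * P * (S * S).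
  have SPP : S * (P * P) = P * P * S by rewrite mulrA SP -mulrA SP mulrA.
  by rewrite -mulrA SPP mulrA SPP -mulrA.
rewrite /binormal /commutator DD DD' -defS -defE; split; last first.
  move=> /eqP; rewrite subr_eq0 => /eqP SE.
  have SSE : S * S * E = E * (S * S) by rewrite -mulrA SE mulrA SE mulrA.
  by rewrite mulrA SSP -(mulrA (P * P)) SSE !mulrA subrr.
move=> SSPPE; pose C := S * S * E - E * (S * S).
(* Moving [P * P] past [S * S] turns the hypothesis into [P * P * C = 0]; the kernels of [P * P],
   [P] and [U] agree. *)
have UC : U * C = 0.
  apply: (@kernel_mul_eq0 _ _ P) => [x /kerPU //|].
  apply: (@kernel_mul_eq0 _ _ (P * P)) => [x PPx|].
    apply: rdot_eq0; rewrite rdot_positive // -[P (P x)]/((P * P) x).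
    by rewrite PPx rdot0r.
  by rewrite -[RHS]SSPPE /C mulrBr (mulrA (P * P) (S * S)) -SSP
    (mulrA (P * P) E) -(mulrA (S * S)).
(* Same argument as for [E] and [P], with [P] in the place of [Q]. *)
have FE : F * E = E * F.
  have : U * (E * (1 - F)) = 0.
    apply: (@kernel_mul_eq0 _ _ P) => [x /kerPU //|].
    by rewrite mulrA -EP -mulrA mulrBr mulr1 PF subrr mulr0.
  move=> /(congr1 ( *%R V)); rewrite mulr0 !mulrA -defF mulrBr mulr1.
  move=> /eqP; rewrite subr_eq0 => /eqP FEF.
  by have := congr1 adjoint FEF; rewrite !adjointM Esa Fsa mulrA -FEF => ->.
have FS : F * S = S by rewrite defF defS !mulrA VUV.
have C0 : C = 0.
  have <- : F * C = C by rewrite /C mulrBr !mulrA FS FE -(mulrA E F) FS.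
  by rewrite defF -mulrA UC mulr0.
suff -> : S * E = E * S by rewrite subrr.
symmetry; apply: commute_positive_sqrt => //.
by symmetry; apply/eqP; rewrite -subr_eq0; apply/eqP.
Qed.
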